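(* Let $(X,d)$ be a compact metric space, $\varphi:X\to X$ a continuous map, and $(Y_m)_{m\in\mathbb N}$ a sequence of subsets of $X$. Then $$\mathrm C^*\Big(\varphi,\bigcup_{m\in\mathbb N}Y_m\Big)=\sup_{m\in\mathbb N}\mathrm C^*(\varphi,Y_m).$$
   Context: Weak complexity index $\mathrm C^*$: for $n\ge1$, $d_n^\varphi(x,y)=\max_{0\le k\le n-1}d(\varphi^k(x),\varphi^k(y))$ and $B_n(x,\varepsilon)$ is the open $d_n^\varphi$-ball. For $Y\subset X$ (not necessarily invariant), $\varepsilon>0$ and $N\ge1$, let $\mathcal C_{\ge N}(Y,\varepsilon)$ be the set of families $C=(B_{n_i}(x_i,\varepsilon))_{i\in I}$ with $x_i\in X$, $n_i\ge N$, covering $Y$; for $s\ge0$ put $M(C,s)=\sum_{i\in I}n_i^{-s}$ and $\Delta(Y,\varepsilon,s)=\lim_{N\to\infty}\inf\{M(C,s):C\in\mathcal C_{\ge N}(Y,\varepsilon)\}$. There is a unique $s_c(Y,\varepsilon)\in[0,+\infty]$ with $\Delta(Y,\varepsilon,s)=0$ for $s>s_c(Y,\varepsilon)$ and $=+\infty$ for $s<s_c(Y,\varepsilon)$. Then $\mathrm C^*(\varphi,Y)=\lim_{\varepsilon\to0}s_c(Y,\varepsilon)=\sup_{\varepsilon>0}s_c(Y,\varepsilon)$. *)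

(* Defs.v *)
From HB Require Import structures.
From mathcomp Require Import all_boot all_order all_algebra.
From mathcomp Require Import all_classical all_reals all_analysis.
Set Implicit Arguments.
Unset Strict Implicit.
Unset Printing Implicit Defensive.
Import Order.TTheory GRing.Theory Num.Theory.
Import numFieldNormedType.Exports.
Local Open Scope classical_set_scope.
Local Open Scope ring_scope.

Definition bowen_dist (R : realType) (X : metricType R) (phi : X -> X)
    (n : nat) (x y : X) : R :=
  \big[Num.max/0]_(k < n) mdist (iter k phi x) (iter k phi y).

Definition bowen_ball (R : realType) (X : metricType R) (phi : X -> X)
    (n : nat) (x : X) (eps : R) : set X :=
  [set y | bowen_dist phi n x y < eps].

(* A family of Bowen balls is given by its centers [x] and its orders [n];
   the index type is arbitrary (possibly empty, infinite or uncountable). *)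
Definition is_bowen_cover (R : realType) (X : metricType R) (phi : X -> X)
    (Y : set X) (eps : R) (N : nat) (I : choiceType)
    (x : I -> X) (n : I -> nat) : Prop :=
  (forall i, (N <= n i)%N) /\
  Y `<=` \bigcup_(i in [set: I]) bowen_ball phi (n i) (x i) eps.

Definition cover_mass (R : realType) (I : choiceType) (n : I -> nat) (s : R) :
    \bar R :=
  (\esum_(i in [set: I]) (((n i)%:R `^ (- s))%:E))%E.

Definition inf_mass (R : realType) (X : metricType R) (phi : X -> X)
    (Y : set X) (eps s : R) (N : nat) : \bar R :=
  ereal_inf [set M | exists (I : choiceType) (x : I -> X) (n : I -> nat),
    is_bowen_cover phi Y eps N x n /\ M = cover_mass n s].

(* [N.+1] since the orders of the balls are at least 1. *)
Definition Delta (R : realType) (X : metricType R) (phi : X -> X)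
    (Y : set X) (eps s : R) : \bar R :=
  limn (fun N => inf_mass phi Y eps s N.+1).

Definition is_critical (R : realType) (X : metricType R) (phi : X -> X)
    (Y : set X) (eps : R) (c : \bar R) : Prop :=
  (0 <= c)%E /\ forall s : R, 0 <= s ->
    ((c < s%:E)%E -> Delta phi Y eps s = 0%E) /\
    ((s%:E < c)%E -> Delta phi Y eps s = +oo%E).

(* [xget] picks the unique value given by [is_critical_exists] and
   [is_critical_unique] below. *)
Definition s_c (R : realType) (X : metricType R) (phi : X -> X)
    (Y : set X) (eps : R) : \bar R :=
  xget 0%E [set c | is_critical phi Y eps c].

Definition Cstar (R : realType) (X : metricType R) (phi : X -> X)
    (Y : set X) : \bar R :=
  lim (s_c phi Y eps @[eps --> (0 : R)^'+]).

Lemma cover_mass_ge0 (R : realType) (I : choiceType) (n : I -> nat) (s : R) :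
  (0 <= cover_mass n s)%E.
Proof. by apply: esum_ge0 => i _; rewrite lee_fin powR_ge0. Qed.

Lemma inf_mass_ge0 (R : realType) (X : metricType R) (phi : X -> X)
  (Y : set X) (eps s : R) (N : nat) : (0 <= inf_mass phi Y eps s N)%E.
Proof.
by apply: le_ereal_inf_tmp => _ [I [x [n [_ ->]]]]; exact: cover_mass_ge0.
Qed.

Lemma inf_mass_nd (R : realType) (X : metricType R) (phi : X -> X)
  (Y : set X) (eps s : R) : nondecreasing_seq (inf_mass phi Y eps s).
Proof.
move=> a b ab; apply: ereal_inf_le_tmp => _ [I [x [n [[Nn cov] ->]]]].
exists I, x, n; split => //; split => // i; exact: leq_trans (Nn i).
Qed.

Lemma DeltaE (R : realType) (X : metricType R) (phi : X -> X)
  (Y : set X) (eps s : R) :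
  Delta phi Y eps s =
  ereal_sup (range (fun N => inf_mass phi Y eps s N.+1)).
Proof.
apply/cvg_lim => //; apply: ereal_nondecreasing_cvgn => a b ab.
exact: inf_mass_nd.
Qed.

Lemma inf_mass_le_Delta (R : realType) (X : metricType R) (phi : X -> X)
  (Y : set X) (eps s : R) (N : nat) :
  (inf_mass phi Y eps s N.+1 <= Delta phi Y eps s)%E.
Proof. by rewrite DeltaE; apply: ereal_sup_ubound; exists N. Qed.

Lemma Delta_ge0 (R : realType) (X : metricType R) (phi : X -> X)
  (Y : set X) (eps s : R) : (0 <= Delta phi Y eps s)%E.
Proof. exact: le_trans (inf_mass_ge0 _ _ _ _ _) (inf_mass_le_Delta _ _ _ _ 0). Qed.

Lemma inf_mass_shift (R : realType) (X : metricType R) (phi : X -> X)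
  (Y : set X) (eps s t : R) (N : nat) : s <= t ->
  (inf_mass phi Y eps t N.+1 <=
     (N.+1%:R `^ (s - t))%:E * inf_mass phi Y eps s N.+1)%E.
Proof.
move=> st.
have p0 : 0 < N.+1%:R `^ (s - t) :> R by rewrite powR_gt0.
rewrite -lee_pdivrMl//.
apply: le_ereal_inf_tmp => _ [I [x [n [cov ->]]]].
rewrite lee_pdivrMl//.
apply: (@le_trans _ _ (cover_mass n t)).
  by apply: ereal_inf_lbound; exists I, x, n.
have [Nn _] := cov.
rewrite /cover_mass /esum; apply: ge_ereal_sup => _ [F [finF FT] <-].
apply: (@le_trans _ _ ((N.+1%:R `^ (s - t))%:E *
   \sum_(i \in F) ((n i)%:R `^ (- s))%:E)%E); last first.
  by rewrite lee_pmul2l//; apply: ereal_sup_ubound; exists F.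
rewrite ge0_mule_fsumr; last by move=> i; rewrite lee_fin powR_ge0.
rewrite !fsbig_finite//=; apply: lee_sum => i _.
rewrite -EFinM lee_fin.
have n0 : 0 < (n i)%:R :> R by rewrite ltr0n; exact: leq_trans (Nn i).
have -> : (n i)%:R `^ (- t) = (n i)%:R `^ (s - t) * (n i)%:R `^ (- s) :> R.
  by rewrite -powRD ?(gt_eqF n0) ?implybT// addrAC subrr add0r.
rewrite ler_wpM2r ?powR_ge0//.
rewrite -(opprB t s) !powRN lef_pV2 ?posrE ?powR_gt0//.
by rewrite ge0_ler_powR ?nnegrE ?subr_ge0// ler_nat.
Qed.

Lemma Delta_lty (R : realType) (X : metricType R) (phi : X -> X)
  (Y : set X) (eps s t : R) : s < t ->
  (Delta phi Y eps s < +oo)%E -> Delta phi Y eps t = 0%E.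
Proof.
move=> st Dy.
have Df : Delta phi Y eps s \is a fin_num by rewrite ge0_fin_numE ?Delta_ge0.
apply/eqP; rewrite eq_le Delta_ge0 andbT DeltaE.
apply: ge_ereal_sup => _ [N _ <-].
have bnd M : (N <= M)%N -> (inf_mass phi Y eps t N.+1 <=
    (M.+1%:R `^ (s - t))%:E * Delta phi Y eps s)%E.
  move=> NM; apply: (@le_trans _ _ (inf_mass phi Y eps t M.+1)).
    exact: inf_mass_nd.
  apply: le_trans (inf_mass_shift _ _ _ _ (ltW st)) _.
  by rewrite lee_pmul2l ?inf_mass_le_Delta// ?lte_fin powR_gt0.
apply/lee_addgt0Pr => e e0; rewrite add0e.
set D := fine (Delta phi Y eps s).
have D0 : 0 <= D by rewrite fine_ge0// Delta_ge0.
set A := ((D + 1) / e) `^ ((t - s)^-1).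
have ts : 0 < t - s by rewrite subr_gt0.
have A0 : 0 <= A by exact: powR_ge0.
set M := maxn N (Num.truncn A).
apply: (le_trans (bnd M (leq_maxl _ _))).
rewrite -(fineK Df) -/D -EFinM lee_fin -(opprB t s) powRN.
have AM : A <= M.+1%:R.
  apply: (le_trans (ltW (truncnS_gt A))).
  by rewrite ler_nat ltnS leq_maxr.
have De0 : 0 <= (D + 1) / e by rewrite divr_ge0 ?addr_ge0// ltW.
have DM : (D + 1) / e <= M.+1%:R `^ (t - s).
  have <- : A `^ (t - s) = (D + 1) / e.
    by rewrite /A -powRrM mulVf ?gt_eqF// powRr1.
  by rewrite ge0_ler_powR ?nnegrE// ltW.
rewrite mulrC ler_pdivrMr ?powR_gt0// mulrC -ler_pdivrMr//.
apply: le_trans DM; rewrite ler_pM2r ?invr_gt0// lerDl ler01 //.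
Qed.

Lemma is_critical_exists (R : realType) (X : metricType R) (phi : X -> X)
  (Y : set X) (eps : R) : exists c, is_critical phi Y eps c.
Proof.
pose S := [set s%:E | s in [set s : R | 0 <= s /\ Delta phi Y eps s = 0%E]].
exists (ereal_inf S); split.
  by apply: le_ereal_inf_tmp => _ [s [s0 _] <-]; rewrite lee_fin.
move=> s s0; split.
  move=> /ereal_inf_lt [_ [t [t0 Dt] <-]]; rewrite lte_fin => ts.
  by apply: (Delta_lty ts); rewrite Dt ltry.
move=> sS; apply/eqP; rewrite -leye_eq leNgt; apply/negP => Ds.
have [t st tS] : exists2 t : R, s < t & (t%:E < ereal_inf S)%E.
  case: (ereal_inf S) sS => [r| |]//.
    rewrite lte_fin => sr; exists ((s + r) / 2); rewrite ?lte_fin.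
      exact: (midf_lt sr).1.
    exact: (midf_lt sr).2.
  by move=> _; exists (s + 1); rewrite ?ltrDl// ltry.
have : (ereal_inf S <= t%:E)%E.
  apply: ereal_inf_lbound; exists t => //; split.
    by rewrite (le_trans s0)// ltW.
  exact: Delta_lty st Ds.
by rewrite leNgt tS.
Qed.

Lemma is_critical_le (R : realType) (X : metricType R) (phi : X -> X)
  (Y Z : set X) (eps del : R) (c d : \bar R) :
  (forall s : R, 0 <= s -> (Delta phi Y eps s <= Delta phi Z del s)%E) ->
  is_critical phi Y eps c -> is_critical phi Z del d -> (c <= d)%E.
Proof.
move=> le_D [c0 cP] [d0 dP]; rewrite leNgt; apply/negP => dc.
have [t dt tc] : exists2 t : R, (d < t%:E)%E & (t%:E < c)%E.
  case: d d0 dc {dP} => [r| |] r0; [|by rewrite ltNge leey|by []].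
  case: c c0 {cP} => [u| |] u0 ru; [|by exists (r + 1); rewrite ?ltry ?lte_fin ?ltrDl|by []].
  rewrite lte_fin in ru.
  by exists ((r + u) / 2); rewrite lte_fin; [exact: (midf_lt ru).1|exact: (midf_lt ru).2].
have t0 : 0 <= t by rewrite -lee_fin (le_trans d0)// ltW.
by have := le_D _ t0; rewrite (cP _ t0).2// (dP _ t0).1.
Qed.

Lemma is_critical_unique (R : realType) (X : metricType R) (phi : X -> X)
  (Y : set X) (eps : R) (c d : \bar R) :
  is_critical phi Y eps c -> is_critical phi Y eps d -> c = d.
Proof.
move=> cP dP; apply/eqP; rewrite eq_le.
rewrite (is_critical_le _ cP dP)//.
by rewrite (is_critical_le _ dP cP).
Qed.

Lemma s_cP (R : realType) (X : metricType R) (phi : X -> X)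
  (Y : set X) (eps : R) : is_critical phi Y eps (s_c phi Y eps).
Proof.
have [c cP] := is_critical_exists phi Y eps.
exact: (@xgetPex _ 0%E [set c | is_critical phi Y eps c] (ex_intro _ c cP)).
Qed.

Lemma s_c_nonincreasing (R : realType) (X : metricType R) (phi : X -> X)
  (Y : set X) (eps del : R) : eps <= del ->
  (s_c phi Y del <= s_c phi Y eps)%E.
Proof.
move=> ed; apply: is_critical_le (s_cP _ _ _) (s_cP _ _ _) => s _.
rewrite DeltaE; apply: ge_ereal_sup => _ [N _ <-].
apply: le_trans (inf_mass_le_Delta _ _ _ _ N).
apply: ereal_inf_le_tmp => _ [I [x [n [[Nn cov] ->]]]].
exists I, x, n; split => //; split => // y /cov [i _ yi].
by exists i => //; exact: lt_le_trans ed.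
Qed.

Lemma Cstar_sup (R : realType) (X : metricType R) (phi : X -> X) (Y : set X) :
  Cstar phi Y = ereal_sup [set s_c phi Y eps | eps in [set eps : R | 0 < eps]].
Proof.
apply/cvg_lim => //.
have -> : [set eps : R | 0 < eps] = [set` Interval (BRight 0) +oo%O].
  by apply/seteqP; split => e /=; rewrite in_itv/= andbT.
apply: nonincreasing_at_right_cvge => //.
by move=> a b _ _ ab; exact: s_c_nonincreasing.
Qed.

(* Main.v *)
(** A cover of the union is obtained by joining covers of the [Y m] whose masses
    exceed the infima by [e / 2 ^ m.+1], so [inf_mass] is countably subadditive
    at each order [N].  Hence [Delta] of the union vanishes at any [s] above all
    the critical exponents of the [Y m], and the critical exponent commutes with
    countable unions at each scale; finally the suprema over the scale and over
    [m] are exchanged. *)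
Require Import Defs.
From HB Require Import structures.
From mathcomp Require Import all_boot all_order all_algebra.
From mathcomp Require Import all_classical all_reals all_analysis.
Import Order.TTheory GRing.Theory Num.Theory.
Import numFieldNormedType.Exports.
Local Open Scope classical_set_scope.
Local Open Scope ring_scope.

(** The fibres [J k] partition the sigma type, and [Tagged] reindexes each of them bijectively. A
    joined cover is indexed by such a type, so its mass splits over [m]. *)
Lemma esum_sigma (R : realType) (T : nat -> choiceType)
    (a : {k : nat & T k} -> \bar R) : (forall p, 0 <= a p)%E ->
  (\esum_(p in [set: {k : nat & T k}]) a p
   = \esum_(k in [set: nat]) \esum_(t in [set: T k]) a (Tagged T t))%E.
Proof.
move=> a0; pose J k : set {k : nat & T k} := Tagged T @` [set: T k].
have -> : [set: {k : nat & T k}] = \bigcup_(k in [set: nat]) J k.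
  by apply/seteqP; split=> // -[k t] _; exists k => //; exists t.
rewrite esum_bigcupT//; last first.
  apply/trivIsetP => i j _ _ ij; rewrite -subset0 => p [[t _ <-] [u _ [ji]]].
  by rewrite ji eqxx in ij.
apply: eq_esum => k _; apply: reindex_esum; split; first exact: imageP.
  (* Boolean equality avoids inverting an equality of dependent pairs. *)
  by move=> t u _ _ /eqP; rewrite eq_Tagged => /eqP.
by move=> p [t _ <-]; exists t.
Qed.

Lemma cover_mass_sigma (R : realType) (I : nat -> choiceType)
    (n : forall m, I m -> nat) (s : R) :
  cover_mass (fun p : {m : nat & I m} => n (tag p) (tagged p)) s
  = (\sum_(m <oo) cover_mass (n m) s)%E.
Proof.
rewrite nneseries_esumT; last by move=> m; exact: cover_mass_ge0.
by rewrite /cover_mass esum_sigma// => p; rewrite lee_fin powR_ge0.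
Qed.

Lemma is_bowen_cover_bigcup (R : realType) (X : metricType R) (phi : X -> X)
    (Y : nat -> set X) (eps : R) (N : nat) (I : nat -> choiceType)
    (x : forall m, I m -> X) (n : forall m, I m -> nat) :
  (forall m, is_bowen_cover phi (Y m) eps N (x m) (n m)) ->
  is_bowen_cover phi (\bigcup_m Y m) eps N
    (fun p : {m : nat & I m} => x (tag p) (tagged p))
    (fun p : {m : nat & I m} => n (tag p) (tagged p)).
Proof.
move=> cov; split=> [[m i]|y [m _ Yy]]; first exact: (cov m).1.
by have [i _ yi] := (cov m).2 y Yy; exists (Tagged I i).
Qed.

Lemma inf_mass_bigcup (R : realType) (X : metricType R) (phi : X -> X)
    (Y : nat -> set X) (eps s : R) (N : nat) :
  (inf_mass phi (\bigcup_m Y m) eps s N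
   <= \sum_(m <oo) inf_mass phi (Y m) eps s N)%E.
Proof.
have mass0 m : (0 <= inf_mass phi (Y m) eps s N)%E by exact: inf_mass_ge0.
(* An infinite term makes the right side infinite; otherwise every infimum is finite and can be
   approached by actual covers. *)
have [[m my]|fin] := pselect (exists m, inf_mass phi (Y m) eps s N = +oo%E).
  by rewrite (nneseries_pinfty _ (k := m))// leey.
apply/lee_addgt0Pr => e e0.
apply: le_trans (epsilon_trick xpredT mass0 (ltW e0)).
(* Index type, centers and orders are packed into one dependent pair, so that a single use of choice
   selects a cover for every [m]. *)
have /choice[C C_P] m :
    exists C : {I : choiceType & (I -> X) * (I -> nat)}%type,
      is_bowen_cover phi (Y m) eps N (tagged C).1 (tagged C).2 /\
      (cover_mass (tagged C).2 s
       < inf_mass phi (Y m) eps s N + (e / (2 ^ m.+1)%:R)%:E)%E.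
  have fin_m : inf_mass phi (Y m) eps s N \is a fin_num.
    by rewrite ge0_fin_numE// ltey; apply/eqP => my; apply: fin; exists m.
  have em0 : 0 < e / (2 ^ m.+1)%:R by rewrite divr_gt0// ltr0n expn_gt0.
  have [_ [I [x [n [cov ->]]]] lt_m] := lb_ereal_inf_adherent em0 fin_m.
  by exists (existT _ I (x, n)).
apply: (@le_trans _ _ (\sum_(m <oo) cover_mass (tagged (C m)).2 s)%E).
  rewrite -cover_mass_sigma; apply: ereal_inf_lbound.
  by do 3 eexists; split; [by apply: is_bowen_cover_bigcup => m; exact: (C_P m).1|].
apply: lee_nneseries => m *; first exact: cover_mass_ge0.
exact: ltW (C_P m).2.
Qed.

Lemma Delta_bigcup_eq0 (R : realType) (X : metricType R) (phi : X -> X)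
    (Y : nat -> set X) (eps s : R) :
  (forall m, Delta phi (Y m) eps s = 0%E) ->
  Delta phi (\bigcup_m Y m) eps s = 0%E.
Proof.
move=> D0; apply/eqP; rewrite eq_le Delta_ge0 andbT DeltaE.
apply: ge_ereal_sup => _ [N _ <-]; apply: le_trans (inf_mass_bigcup _ _ _ _ _ _ _) _.
(* [Delta] bounds [inf_mass] at every order, so each term is already zero at order [N.+1]; no limit
   is exchanged with the series. *)
rewrite eseries0// => m _ _; apply/eqP.
by rewrite eq_le inf_mass_ge0 -(D0 m) inf_mass_le_Delta.
Qed.

Lemma Delta_subset (R : realType) (X : metricType R) (phi : X -> X)
    (A B : set X) (eps s : R) : A `<=` B ->
  (Delta phi A eps s <= Delta phi B eps s)%E.
Proof.
move=> AB; rewrite DeltaE; apply: ge_ereal_sup => _ [N _ <-].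
apply: le_trans (inf_mass_le_Delta _ _ _ _ N).
apply: ereal_inf_le_tmp => _ [I [x [n [[Nn cov] ->]]]].
by exists I, x, n; split=> //; split=> //; exact: subset_trans cov.
Qed.

(** The supremum [c] is itself critical for the union, so uniqueness applies. Above [c], every
    [Delta] of a [Y m] vanishes; below [c], some [Y m] has infinite [Delta], and monotonicity passes
    this to the union. *)
Lemma s_c_bigcup (R : realType) (X : metricType R) (phi : X -> X)
    (Y : nat -> set X) (eps : R) :
  s_c phi (\bigcup_m Y m) eps
  = ereal_sup [set s_c phi (Y m) eps | m in [set: nat]].
Proof.
set c := ereal_sup _.
have le_c m : (s_c phi (Y m) eps <= c)%E by apply: ereal_sup_ubound; exists m.
apply: is_critical_unique (s_cP _ _ _) _; split.
  by apply: le_trans (le_c 0%N); exact: (s_cP _ _ _).1.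
move=> s s0; split=> [cs|/ereal_sup_gt[_ [m _ <-] sm]].
  apply: Delta_bigcup_eq0 => m.
  by apply: ((s_cP phi (Y m) eps).2 s s0).1; exact: le_lt_trans cs.
apply/eqP; rewrite -leye_eq -(((s_cP phi (Y m) eps).2 s s0).2 sm).
exact/Delta_subset/bigcup_sup.
Qed.

Theorem proposition2p3 (R : realType) (X : metricType R) (phi : X -> X)
    (Y : nat -> set X)
    (cptX : compact [set: X]) (cphi : continuous phi) :
  Cstar phi (\bigcup_(m in [set: nat]) Y m)
  = ereal_sup [set Cstar phi (Y m) | m in [set: nat]].
Proof.
rewrite Cstar_sup; apply/eqP; rewrite eq_le; apply/andP; split.
  apply: ge_ereal_sup => _ [eps eps0 <-]; rewrite s_c_bigcup.
  apply: ge_ereal_sup => _ [m _ <-].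
  apply: (@le_trans _ _ (Cstar phi (Y m))).
    by rewrite Cstar_sup; apply: ereal_sup_ubound; exists eps.
  by apply: ereal_sup_ubound; exists m.
(* Conversely, at each scale the exponent of [Y m] is at most that of the union. *)
apply: ge_ereal_sup => _ [m _ <-]; rewrite Cstar_sup.
apply: ge_ereal_sup => _ [eps eps0 <-].
apply: (@le_trans _ _ (s_c phi (\bigcup_m Y m) eps)).
  by rewrite s_c_bigcup; apply: ereal_sup_ubound; exists m.
by apply: ereal_sup_ubound; exists eps.
Qed.
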